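(* Let $(M^n,h)$ and $(L^k,g)$ be oriented Riemannian manifolds with $n\ge k$, let $u\colon M\to L$ be a smooth surjection, and let $\alpha\in\Omega^{n-k}(M)$ be a calibration (not necessarily closed). Put $\lambda=\frac{|du|}{\sqrt k}$. Then $$\alpha\wedge u^*\mathrm{vol}_L\le\lambda^k\,\mathrm{vol}_M$$ at every point of $M$. Moreover, equality holds (at all points of $M$) if and only if both of the following hold: (1) $u^*g=\lambda^2h^{(0,2)}$ (that is, $u$ is weakly horizontally conformal); (2) the fibres of the restriction of $u$ to $M^0=\{x\in M:du_x\neq0\}$ are calibrated with respect to $\alpha$.
   Context: Manifolds are smooth and oriented, not necessarily compact. A form $\alpha\in\Omega^{m}(M)$ on $(M,h)$ is a calibration if $|\alpha(e_1,\dots,e_m)|\le 1$ for all orthonormal $e_1,\dots,e_m\in T_xM$, $x\in M$. An oriented $m$-dimensional subspace of $T_xM$ is $\alpha$-calibrated if $\alpha(e_1,\dots,e_m)=1$ for an oriented orthonormal basis; an oriented submanifold is $\alpha$-calibrated if all its tangent spaces are. $|du|^2=\operatorname{tr}_h(u^*g)$. $u$ is weakly horizontally conformal if for every $x\in M$ either $du_x=0$, or $du_x$ has rank $k$ and $u^*g=\lambda^2h^{(0,2)}$ at $x$ for some $\lambda(x)>0$ (then necessarily $\lambda^2=\frac1k|du|^2$), where $h^{(0,2)}$ is the horizontal part of $h$: it equals $h$ on $(\ker du_x)^\perp$ and vanishes if either argument is in $\ker du_x$. The equation $u^*g=\lambda^2h^{(0,2)}$ in (1) means exactly this property with $\lambda=|du|/\sqrt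 k$. In that case $u|_{M^0}$ is a submersion. At points where $du_x$ has rank $k$, $(\ker du_x)^\perp$ is oriented by $u^*\mathrm{vol}_L$, and $\ker du_x$ (the tangent space of the fibre) is oriented so that $\mathrm{vol}_{\ker du}\wedge\mathrm{vol}_{(\ker du)^\perp}=\mathrm{vol}_M$. Inequalities between $n$-forms on $M$ are inequalities of their coefficients with respect to the volume form $\mathrm{vol}_M$. *)

(* Defs.v *)
From HB Require Import structures.
From mathcomp Require Import all_boot all_order all_algebra all_fingroup.
From mathcomp Require Import all_classical all_reals all_analysis.

Set Implicit Arguments.
Unset Strict Implicit.
Unset Printing Implicit Defensive.

Import Order.TTheory GRing.Theory Num.Theory.
Import numFieldNormedType.Exports.

Local Open Scope classical_set_scope.
Local Open Scope ring_scope.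

(** * Smooth manifolds *)

(* Meaningful for open [U]: [f] has continuous iterated directional
   derivatives up to order [r] on [U]. *)
Fixpoint Ck_on (R : realType) (V W : normedModType R) (r : nat) (U : set V)
    (f : V -> W) : Prop :=
  match r with
  | 0 => forall x, U x -> {for x, continuous f}
  | r'.+1 => (forall x, U x -> differentiable f x) /\
             (forall v : V, Ck_on r' U (fun x => 'D_v f x))
  end.

Definition smooth_on (R : realType) (V W : normedModType R) (U : set V)
    (f : V -> W) : Prop :=
  forall r, Ck_on r U f.

(* [cfun] and [cinv] are total, but only their restrictions to [cdom] and
   [cfun @` cdom] matter. *)
Record chart (R : realType) (n : nat) (T : topologicalType) := Chart {
  cdom : set T ;
  cfun : T -> 'rV[R]_n ;
  cinv : 'rV[R]_n -> T ;
  cdom_open : open cdom ;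
  cimg_open : open (cfun @` cdom) ;
  cfunK : forall x, cdom x -> cinv (cfun x) = x ;
  cfun_continuous : forall x, cdom x -> {for x, continuous cfun} ;
  cinv_continuous : forall z, (cfun @` cdom) z -> {for z, continuous cinv} }.

Definition cimg (R : realType) (n : nat) (T : topologicalType)
  (c : chart R n T) : set 'rV[R]_n := cfun c @` cdom c.

(* [chart_at x] is an arbitrary chosen chart around [x]; it serves to identify
   the tangent space at [x] with R^n. *)
Record manifold (R : realType) (n : nat) := Manifold {
  carrier :> topologicalType ;
  atlas : set (chart R n carrier) ;
  chart_at : carrier -> chart R n carrier ;
  manifold_hausdorff : hausdorff_space carrier ;
  manifold_second_countable : @second_countable carrier ;
  chart_at_atlas : forall x, atlas (chart_at x) ;
  chart_at_dom : forall x, cdom (chart_at x) x ;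
  transition_smooth : forall c d, atlas c -> atlas d ->
    smooth_on (cfun c @` (cdom c `&` cdom d)) (cfun d \o cinv c) }.

(* Throughout, the tangent space at [x] is 'rV[R]_n, a tangent vector being given
   by its coordinates in [chart_at x]. An m-tuple of tangent vectors is the
   m x n matrix whose rows are these vectors, and a bilinear form b is the
   n x n matrix B with b(v, w) = v B w^T. *)

Definition smooth_map (R : realType) (n k : nat) (M : manifold R n)
    (L : manifold R k) (u : M -> L) : Prop :=
  continuous u /\
  forall (c : chart R n M) (d : chart R k L), atlas c -> atlas d ->
    smooth_on (cfun c @` (cdom c `&` u @^-1` cdom d))
              (cfun d \o u \o cinv c).

(* Matrix of du_x : T_xM -> T_{u x}L, acting on row vectors by v |-> v *m du. *)
Definition tangent_map (R : realType) (n k : nat) (M : manifold R n)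
    (L : manifold R k) (u : M -> L) (x : M) : 'M[R]_(n, k) :=
  'J (cfun (chart_at (u x)) \o u \o cinv (chart_at x)) (cfun (chart_at x) x).

(* Row [i] is the coordinate vector field d/dc^i of the chart [c] at [y],
   as an element of the tangent space at [y]. *)
Definition chart_frame (R : realType) (n : nat) (M : manifold R n)
    (c : chart R n M) (y : M) : 'M[R]_n :=
  'J (cfun (chart_at y) \o cinv c) (cfun c y).

(** * Metrics, orientations, forms *)

Record metric (R : realType) (n : nat) (M : manifold R n) := Metric {
  mval :> forall x : M, 'M[R]_n ;
  metric_sym : forall x, (mval x)^T = mval x ;
  metric_pos : forall x (v : 'rV[R]_n), v != 0 ->
    0 < (v *m mval x *m v^T) 0 0 ;
  metric_smooth : forall (c : chart R n M) (i j : 'I_n), atlas c ->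
    smooth_on (cimg c) (fun z => (chart_frame c (cinv c z)
      *m mval (cinv c z) *m (chart_frame c (cinv c z))^T) i j : R^o) }.

(* [oval x] tells whether the orientation of the tangent space at [x] is
   opposite to the standard one of R^n. *)
Record orientation (R : realType) (n : nat) (M : manifold R n) := Orientation {
  oval :> M -> bool ;
  orientation_locally_constant : forall (c : chart R n M) (x : M),
    atlas c -> cdom c x ->
    \forall y \near x,
      (-1) ^+ oval y * Num.sg (\det (chart_frame c y)) =
      (-1) ^+ oval x * Num.sg (\det (chart_frame c x)) }.

Definition multilinear (R : realType) (m n : nat) (a : 'M[R]_(m, n) -> R) :=
  forall (i : 'I_m) (r : R) (A B C : 'M[R]_(m, n)),
    row i A = r *: row i B + row i C ->
    row' i B = row' i A -> row' i C = row' i A ->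
    a A = r * a B + a C.

Definition alternating (R : realType) (m n : nat) (a : 'M[R]_(m, n) -> R) :=
  forall (A : 'M[R]_(m, n)) (i j : 'I_m), i != j -> row i A = row j A -> a A = 0.

Record dform (R : realType) (n : nat) (M : manifold R n) (m : nat) := DForm {
  fval :> forall x : M, 'M[R]_(m, n) -> R ;
  dform_multilinear : forall x, multilinear (fval x) ;
  dform_alternating : forall x, alternating (fval x) ;
  dform_smooth : forall (c : chart R n M) (f : 'I_m -> 'I_n), atlas c ->
    smooth_on (cimg c)
      (fun z => fval (cinv c z) (rowsub f (chart_frame c (cinv c z))) : R^o) }.

(* Normalised so that (e^1 /\ ... /\ e^n)(e_1, ..., e_n) = 1. *)
Definition wedge (R : realType) (m k n : nat) (a : 'M[R]_(m, n) -> R)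
    (b : 'M[R]_(k, n) -> R) (A : 'M[R]_(m + k, n)) : R :=
  ((m`! * k`!)%:R)^-1 *
  \sum_(s : 'S_(m + k))
     (-1) ^+ s * (a (usubmx (row_perm s A)) * b (dsubmx (row_perm s A))).

Definition castdeg (R : realType) (m m' n : nat) (e : m = m')
    (a : 'M[R]_(m, n) -> R) (A : 'M[R]_(m', n)) : R :=
  a (castmx (esym e, erefl n) A).

Definition pullback_form (R : realType) (m n k : nat) (D : 'M[R]_(n, k))
    (b : 'M[R]_(m, k) -> R) (A : 'M[R]_(m, n)) : R := b (A *m D).

Definition pullback_bilin (R : realType) (n k : nat) (D : 'M[R]_(n, k))
    (G : 'M[R]_k) : 'M[R]_n := D *m G *m D^T.

(* sqrt(det h) dx^1 /\ ... /\ dx^n, up to the sign of the orientation. *)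
Definition vol (R : realType) (n : nat) (M : manifold R n) (h : metric M)
    (o : orientation M) (x : M) (A : 'M[R]_n) : R :=
  (-1) ^+ o x * Num.sqrt (\det (h x)) * \det A.

Definition top_form_le (R : realType) (n : nat) (w a b : 'M[R]_n -> R) : Prop :=
  exists p q : R, [/\ forall A, a A = p * w A, forall A, b A = q * w A & p <= q].

(** * Linear algebra of a Euclidean tangent space with Gram matrix [H] *)

Definition orthonormal_frame (R : realType) (m n : nat) (H : 'M[R]_n)
    (E : 'M[R]_(m, n)) : Prop := E *m H *m E^T = 1%:M.

(* Subspaces are row spaces of matrices. *)
Definition orthonormal_basis (R : realType) (m n : nat) (H V : 'M[R]_n)
    (E : 'M[R]_(m, n)) : Prop := orthonormal_frame H E /\ (E == V)%MS.

Definition orthocomplement (R : realType) (n : nat) (H V : 'M[R]_n) : 'M[R]_n :=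
  kermx (H *m V^T).

Definition trace_wrt (R : realType) (n : nat) (H B : 'M[R]_n) : R :=
  \tr (invmx H *m B).

(* [B] is the part of [H] that is horizontal with respect to [ker D]. *)
Definition horizontal_part (R : realType) (n k : nat) (D : 'M[R]_(n, k))
    (H B : 'M[R]_n) : Prop :=
  (forall v w : 'rV[R]_n,
     (v <= orthocomplement H (kermx D))%MS ->
     (w <= orthocomplement H (kermx D))%MS ->
     v *m B *m w^T = v *m H *m w^T) /\
  (forall v w : 'rV[R]_n, (v <= kermx D)%MS || (w <= kermx D)%MS ->
     v *m B *m w^T = 0).

(* [pos E] says that the basis [E] of [V] is positively oriented. For m = 0
   the only basis is the empty one; if the orientation of V = 0 is the negative
   one, the oriented basis is the empty basis taken with the sign -1. *)
Definition calibrated_subspace (R : realType) (m n : nat) (H : 'M[R]_n)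
    (a : 'M[R]_(m, n) -> R) (V : 'M[R]_n) (pos : 'M[R]_(m, n) -> Prop) : Prop :=
  exists2 E, orthonormal_basis H V E &
    (pos E /\ a E = 1) \/ [/\ m = 0%N, ~ pos E & a E = -1].

(** * Calibrations and weakly horizontally conformal maps *)

Definition calibration (R : realType) (n m : nat) (M : manifold R n)
    (h : metric M) (a : dform M m) : Prop :=
  forall (x : M) (E : 'M[R]_(m, n)), orthonormal_frame (h x) E -> `|a x E| <= 1.

Definition norm_du (R : realType) (n k : nat) (M : manifold R n)
    (L : manifold R k) (h : metric M) (g : metric L) (u : M -> L) (x : M) : R :=
  Num.sqrt (trace_wrt (h x) (pullback_bilin (tangent_map u x) (g (u x)))).

Definition dilation (R : realType) (n k : nat) (M : manifold R n)
    (L : manifold R k) (h : metric M) (g : metric L) (u : M -> L) (x : M) : R :=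
  norm_du h g u x / Num.sqrt k%:R.

Definition weakly_horizontally_conformal (R : realType) (n k : nat)
    (M : manifold R n) (L : manifold R k) (h : metric M) (g : metric L)
    (u : M -> L) : Prop :=
  forall x : M, tangent_map u x = 0 \/
    (\rank (tangent_map u x) = k /\
     exists2 B, horizontal_part (tangent_map u x) (h x) B &
       pullback_bilin (tangent_map u x) (g (u x)) =
         dilation h g u x ^+ 2 *: B).

(* Positivity of a basis [E] of ker du_x: the orthogonal complement is oriented
   by u^* vol_L, and ker du_x by vol_ker /\ vol_perp = vol_M, whose value on
   bases (E, F) is vol_ker(E) vol_perp(F). *)
Definition positive_ker (R : realType) (n k : nat) (le_kn : (k <= n)%N)
    (M : manifold R n) (L : manifold R k) (h : metric M) (oM : orientation M)
    (g : metric L) (oL : orientation L) (u : M -> L) (x : M)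
    (E : 'M[R]_(n - k, n)) : Prop :=
  exists F : 'M[R]_(k, n),
    [/\ orthonormal_basis (h x)
          (orthocomplement (h x) (kermx (tangent_map u x))) F,
        0 < pullback_form (tangent_map u x) (vol g oL (u x)) F &
        0 < vol h oM x (castmx (subnK le_kn, erefl n) (col_mx E F))].

Definition regular_fibre (R : realType) (n k : nat) (M : manifold R n)
    (L : manifold R k) (u : M -> L) (p : L) : set M :=
  [set x | tangent_map u x <> 0 /\ u x = p].

Definition calibrated_fibres (R : realType) (n k : nat) (le_kn : (k <= n)%N)
    (M : manifold R n) (L : manifold R k) (h : metric M) (oM : orientation M)
    (g : metric L) (oL : orientation L) (u : M -> L)
    (a : dform M (n - k)) : Prop :=
  forall (p : L) (x : M), regular_fibre u p x ->
    calibrated_subspace (h x) (a x) (kermx (tangent_map u x))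
      (positive_ker le_kn h oM g oL u x).

Definition wedge_pullback_vol (R : realType) (n k : nat) (le_kn : (k <= n)%N)
    (M : manifold R n) (L : manifold R k) (g : metric L) (oL : orientation L)
    (u : M -> L) (a : dform M (n - k)) (x : M) : 'M[R]_n -> R :=
  castdeg (subnK le_kn)
    (wedge (a x) (pullback_form (tangent_map u x) (vol g oL (u x)))).

(* Main.v *)
(** Everything happens in a single tangent space. If du_x has rank less than k,
    the wedge product vanishes. If the rank is k, evaluate it on an orthonormal
    frame (E, F) with E spanning ker du and F its orthogonal complement: the
    value is alpha(E) u^*vol_L(F), and (u^*vol_L(F))^2 is the determinant of the
    Gram matrix S of du(F), whose trace is |du|^2. The bound is |alpha(E)| <= 1
    together with the arithmetic-geometric mean inequality
    det S <= (tr S / k)^k. Equality in the latter means that S is scalar, i.e.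
    conformality, and equality in the former that ker du is calibrated. *)

Require Import Defs.
From HB Require Import structures.
From mathcomp Require Import all_boot all_order all_algebra all_fingroup.
From mathcomp Require Import all_classical all_reals all_analysis.
From mathcomp Require Import ring.
Import Order.TTheory GRing.Theory Num.Theory.
Import numFieldNormedType.Exports.
Local Open Scope classical_set_scope.
Local Open Scope ring_scope.

Set Implicit Arguments.
Unset Strict Implicit.
Unset Printing Implicit Defensive.

(** * Multilinear alternating forms *)

Lemma row'_eqP (T : Type) (m n : nat) (i : 'I_m) (A B : 'M[T]_(m, n)) :
  row' i A = row' i B <-> forall j, j != i -> row j A = row j B.
Proof.
split=> [eqAB j ji | eqAB]; last first.
  apply/matrixP => j l; rewrite !mxE.
  have ji : lift i j != i by rewrite eq_sym neq_lift.
  by have /rowP/(_ l) := eqAB _ ji; rewrite !mxE.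
apply/rowP => l; rewrite !mxE.
have [j' -> | ij] := unliftP i j; last by rewrite ij eqxx in ji.
by have /matrixP/(_ j' l) := eqAB; rewrite !mxE.
Qed.

Lemma multilinearP (R : realType) (m n : nat) (a : 'M[R]_(m, n) -> R) :
  multilinear a <->
  forall (i : 'I_m) (r : R) (A B C : 'M[R]_(m, n)),
    row i A = r *: row i B + row i C ->
    (forall j, j != i -> row j B = row j A) ->
    (forall j, j != i -> row j C = row j A) ->
    a A = r * a B + a C.
Proof.
split=> ml i r A B C eqA eqB eqC.
- by apply: (ml i) => //; apply/row'_eqP.
- by apply: (ml i) => //; apply/row'_eqP.
Qed.

Definition set_row (T : Type) (m n : nat) (i : 'I_m) (v : 'rV[T]_n)
    (A : 'M[T]_(m, n)) : 'M[T]_(m, n) :=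
  \matrix_(j, l) if j == i then v 0 l else A j l.

Lemma row_set_row (T : Type) (m n : nat) (i : 'I_m) (v : 'rV[T]_n)
    (A : 'M[T]_(m, n)) (j : 'I_m) :
  row j (set_row i v A) = if j == i then v else row j A.
Proof. by apply/rowP => l; rewrite !mxE; case: ifP; rewrite ?mxE. Qed.

Lemma row_set_row_same (T : Type) (m n : nat) (i : 'I_m) (v : 'rV[T]_n)
    (A : 'M[T]_(m, n)) : row i (set_row i v A) = v.
Proof. by rewrite row_set_row eqxx. Qed.

Lemma set_row_row (T : Type) (m n : nat) (i : 'I_m) (A : 'M[T]_(m, n)) :
  set_row i (row i A) A = A.
Proof. by apply/matrixP => j l; rewrite !mxE; case: eqP => // ->. Qed.

Lemma multilinear_set_row (R : realType) (m n : nat) (f : 'M[R]_(m, n) -> R)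
    (i : 'I_m) (r : R) (v w : 'rV[R]_n) (A : 'M[R]_(m, n)) :
  multilinear f ->
  f (set_row i (r *: v + w) A) = r * f (set_row i v A) + f (set_row i w A).
Proof.
move/multilinearP => ml; apply: (ml i); first by rewrite !row_set_row_same.
- by move=> j /negPf ji; rewrite !row_set_row ji.
- by move=> j /negPf ji; rewrite !row_set_row ji.
Qed.

Lemma multilinear_row0 (R : realType) (m n : nat) (f : 'M[R]_(m, n) -> R)
    (i : 'I_m) (A : 'M[R]_(m, n)) :
  multilinear f -> row i A = 0 -> f A = 0.
Proof.
move=> ml A0; have := multilinear_set_row i 1 0 0 A ml.
rewrite scaler0 addr0 -A0 set_row_row mul1r => /eqP.
by rewrite -subr_eq0 opprD addNKr oppr_eq0 => /eqP.
Qed.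

Lemma multilinear_row_eq0 (R : realType) (m n : nat) (f : 'M[R]_(m, n) -> R)
    (i : 'I_m) (A : 'M[R]_(m, n)) :
  multilinear f -> (forall l, f (set_row i (delta_mx 0 l) A) = 0) -> f A = 0.
Proof.
move=> ml f0; rewrite -(set_row_row i A) [X in set_row _ X _]row_sum_delta.
elim: (index_enum _) => [|l s IHs].
  by rewrite big_nil (multilinear_row0 (i := i)) ?row_set_row_same.
by rewrite big_cons multilinear_set_row // f0 IHs mulr0 addr0.
Qed.

Lemma alternating_row_tperm (R : realType) (m n : nat) (f : 'M[R]_(m, n) -> R)
    (i j : 'I_m) (A : 'M[R]_(m, n)) :
  multilinear f -> Defs.alternating f -> i != j ->
  f (row_perm (tperm i j) A) = - f A.
Proof.
move=> ml alt ij; pose g v w := f (set_row i v (set_row j w A)).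
have gv v : g v v = 0.
  by apply: (alt _ i j) => //; rewrite !row_set_row !eqxx eq_sym (negPf ij).
have setC v w : set_row i v (set_row j w A) = set_row j w (set_row i v A).
  apply/matrixP => p l; rewrite !mxE; have [->|] := eqVneq p i => //.
  by rewrite (negPf ij).
have gDl v v' w : g (v + v') w = g v w + g v' w.
  by rewrite /g -[v]scale1r multilinear_set_row // mul1r scale1r.
have gDr v w w' : g v (w + w') = g v w + g v w'.
  by rewrite /g !setC -[w]scale1r multilinear_set_row // mul1r scale1r.
have := gv (row i A + row j A).
rewrite gDl !gDr !gv addr0 add0r => /eqP; rewrite addrC addr_eq0 => /eqP.
rewrite /g set_row_row set_row_row => <-; congr f.
apply/matrixP => p l; rewrite !mxE.
case: tpermP => [->|->|/eqP/negPf-> /eqP/negPf->] //; rewrite ?eqxx //.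
by rewrite eq_sym (negPf ij).
Qed.

Lemma top_form_eq0 (R : realType) (n : nat) (f : 'M[R]_n -> R) :
  multilinear f -> Defs.alternating f -> f 1%:M = 0 -> forall A, f A = 0.
Proof.
move=> ml alt f1.
have fperm (s : 'S_n) : f (row_perm s 1%:M) = 0.
  have [ts -> dts] := prod_tpermP s.
  elim: ts dts => [_|t ts IHts /= /andP[dt dts]].
    by rewrite big_nil row_perm1.
  rewrite big_cons row_permM alternating_row_tperm ?IHts ?oppr0 //.
suff fj (j : nat) A : (forall i : 'I_n, (j <= i)%N ->
    exists l, row i A = delta_mx 0 l) -> f A = 0.
  by move=> A; apply: (fj n) => i; rewrite leqNgt ltn_ord.
elim: j A => [A rA|j IHj A rA].
  have /choice[s sE] : forall i, exists l, row i A = delta_mx 0 l.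
    by move=> i; apply: rA.
  have [/injectiveP sI | /injectivePn[p [q pq spq]]] := boolP (injectiveb s).
    rewrite -(fperm (perm sI)); congr f; apply/row_matrixP => i.
    by rewrite sE row_permEsub row_rowsub permE row1.
  by apply: (alt _ p q) => //; rewrite !sE spq.
have [jn|nj] := ltnP j n; last first.
  by apply: IHj => i ji; move: (leq_trans nj ji); rewrite leqNgt ltn_ord.
apply: (multilinear_row_eq0 (i := Ordinal jn)) => // l; apply: IHj => i ji.
rewrite row_set_row; case: eqP => [_|/eqP ij]; first by exists l.
by apply: rA; rewrite ltn_neqAle ji andbT eq_sym.
Qed.

Lemma multilinear_det (R : realType) (n : nat) :
  multilinear (fun A : 'M[R]_n => \det A).
Proof.
move=> i r A B C eA eB eC; rewrite (determinant_multilinear (b := r) (c := 1)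
  _ eB eC).
  by rewrite mul1r.
by rewrite scale1r.
Qed.

Lemma alternating_det (R : realType) (n : nat) :
  Defs.alternating (fun A : 'M[R]_n => \det A).
Proof.
move=> A i j ij /rowP eqA; apply: (determinant_alternate ij) => l.
by have := eqA l; rewrite !mxE.
Qed.

Lemma top_formE (R : realType) (n : nat) (f : 'M[R]_n -> R) (A : 'M[R]_n) :
  multilinear f -> Defs.alternating f -> f A = f 1%:M * \det A.
Proof.
move=> ml alt; apply/eqP; rewrite -subr_eq0; apply/eqP.
apply: (top_form_eq0 (f := fun A => f A - f 1%:M * \det A)) A.
- move=> i r A B C eA eB eC; rewrite (ml _ _ _ _ _ eA eB eC).
  rewrite (multilinear_det eA eB eC) mulrBr mulrDr opprD addrACA.
  by rewrite mulrCA.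
- by move=> A i j ij eqA; rewrite (alt _ _ _ ij eqA) (alternating_det ij eqA)
    mulr0 subr0.
- by rewrite det1 mulr1 subrr.
Qed.

Lemma multilinear_mulmxr (R : realType) (m n p : nat) (f : 'M[R]_(m, p) -> R)
    (D : 'M[R]_(n, p)) :
  multilinear f -> multilinear (fun A : 'M[R]_(m, n) => f (A *m D)).
Proof.
move/multilinearP => ml; apply/multilinearP => i r A B C eA eB eC.
apply: (ml i); first by rewrite !row_mul eA mulmxDl scalemxAl.
- by move=> j ji; rewrite !row_mul eB.
- by move=> j ji; rewrite !row_mul eC.
Qed.

Lemma alternating_mulmxr (R : realType) (m n p : nat) (f : 'M[R]_(m, p) -> R)
    (D : 'M[R]_(n, p)) :
  Defs.alternating f -> Defs.alternating (fun A : 'M[R]_(m, n) => f (A *m D)).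
Proof. by move=> alt A i j ij eqA; apply: (alt _ i j); rewrite // !row_mul
  eqA. Qed.

Lemma alternating_mulmx (R : realType) (m n : nat) (f : 'M[R]_(m, n) -> R)
    (P : 'M[R]_m) (A : 'M[R]_(m, n)) :
  multilinear f -> Defs.alternating f -> f (P *m A) = \det P * f A.
Proof.
move=> ml alt.
rewrite (top_formE (f := fun P => f (P *m A))) ?mul1mx 1?mulrC //.
- exact: multilinear_mulmxr.
- exact: alternating_mulmxr.
Qed.

(** * The wedge product *)

Lemma multilinear_wedge (R : realType) (m k n : nat) (a : 'M[R]_(m, n) -> R)
    (b : 'M[R]_(k, n) -> R) :
  multilinear a -> multilinear b -> multilinear (wedge a b).
Proof.
move=> /multilinearP mla /multilinearP mlb; apply/multilinearP.
move=> i r A B C eA eB eC; rewrite /wedge [r * _]mulrCA -mulrDr; congr (_ * _).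
rewrite big_distrr -big_split /=; apply: eq_bigr => s _.
rewrite [r * _]mulrCA -mulrDr; congr (_ * _).
have rowu X p : row p (usubmx (row_perm s X)) = row (s (lshift k p)) X.
  by apply/rowP => l; rewrite !mxE.
have rowd X p : row p (dsubmx (row_perm s X)) = row (s (rshift m p)) X.
  by apply/rowP => l; rewrite !mxE.
case: (split_ordP (s^-1 i)%g) => p ip.
  have {}ip : i = s (lshift k p) by rewrite -ip permKV.
  have -> : dsubmx (row_perm s B) = dsubmx (row_perm s A).
    apply/row_matrixP => q; rewrite !rowd eB // ip (inj_eq perm_inj).
    by rewrite eq_sym eq_lrshift.
  have -> : dsubmx (row_perm s C) = dsubmx (row_perm s A).
    apply/row_matrixP => q; rewrite !rowd eC // ip (inj_eq perm_inj).
    by rewrite eq_sym eq_lrshift.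
  rewrite (mla p r _ (usubmx (row_perm s B)) (usubmx (row_perm s C))).
  - by rewrite mulrDl mulrA.
  - by rewrite !rowu -ip.
  - by move=> q qp; rewrite !rowu eB // ip (inj_eq perm_inj) eq_lshift.
  - by move=> q qp; rewrite !rowu eC // ip (inj_eq perm_inj) eq_lshift.
have {}ip : i = s (rshift m p) by rewrite -ip permKV.
have -> : usubmx (row_perm s B) = usubmx (row_perm s A).
  apply/row_matrixP => q; rewrite !rowu eB // ip (inj_eq perm_inj).
  by rewrite eq_lrshift.
have -> : usubmx (row_perm s C) = usubmx (row_perm s A).
  apply/row_matrixP => q; rewrite !rowu eC // ip (inj_eq perm_inj).
  by rewrite eq_lrshift.
rewrite (mlb p r _ (dsubmx (row_perm s B)) (dsubmx (row_perm s C))).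
- by rewrite mulrDr mulrCA.
- by rewrite !rowd -ip.
- by move=> q qp; rewrite !rowd eB // ip (inj_eq perm_inj) eq_rshift.
- by move=> q qp; rewrite !rowd eC // ip (inj_eq perm_inj) eq_rshift.
Qed.

Lemma alternating_wedge (R : realType) (m k n : nat) (a : 'M[R]_(m, n) -> R)
    (b : 'M[R]_(k, n) -> R) : Defs.alternating (wedge a b).
Proof.
move=> A i j ij eqA; rewrite /wedge.
set S := (X in _ * X); suff : S = - S.
  move=> /eqP; rewrite -addr_eq0 -mulr2n mulrn_eq0 /= => /eqP ->.
  by rewrite mulr0.
have permA : row_perm (tperm i j) A = A.
  apply/row_matrixP => p; rewrite row_permEsub row_rowsub.
  by case: tpermP => [->|->|].
rewrite {1}/S (reindex_inj (mulIg (tperm i j))) /= /S -sumrN.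
apply: eq_bigr => s _; rewrite -mulNr; congr (_ * (a _ * b _)).
- by rewrite odd_permM odd_tperm ij addbT; case: odd_perm; rewrite ?opprK.
- by rewrite row_permM permA.
- by rewrite row_permM permA.
Qed.

Definition block_perm_fun (m k : nat) (pq : 'S_m * 'S_k) (i : 'I_(m + k)) :
    'I_(m + k) :=
  match fintype.split i with
  | inl j => lshift k (pq.1 j)
  | inr j => rshift m (pq.2 j)
  end.

Lemma block_perm_fun_inj (m k : nat) (pq : 'S_m * 'S_k) :
  injective (block_perm_fun pq).
Proof.
move=> i j; rewrite /block_perm_fun.
case: (split_ordP i) => i' ->; case: (split_ordP j) => j' -> /eqP;
  rewrite ?eq_lshift ?eq_rshift ?eq_lrshift ?eq_rlshift //.
- by rewrite (inj_eq perm_inj) => /eqP->.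
- by rewrite (inj_eq perm_inj) => /eqP->.
Qed.

Definition block_perm (m k : nat) (pq : 'S_m * 'S_k) : 'S_(m + k) :=
  perm (block_perm_fun_inj (pq := pq)).

Lemma block_permEl (m k : nat) (pq : 'S_m * 'S_k) (i : 'I_m) :
  block_perm pq (lshift k i) = lshift k (pq.1 i).
Proof. by rewrite permE /block_perm_fun (unsplitK (inl i)). Qed.

Lemma block_permEr (m k : nat) (pq : 'S_m * 'S_k) (i : 'I_k) :
  block_perm pq (rshift m i) = rshift m (pq.2 i).
Proof. by rewrite permE /block_perm_fun (unsplitK (inr i)). Qed.

Lemma block_perm_inj (m k : nat) : injective (@block_perm m k).
Proof.
move=> [p q] [p' q'] /permP eqb; congr pair; apply/permP => i.
- by apply/(@lshift_inj m k); have := eqb (lshift k i); rewrite !block_permEl.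
- by apply/(@rshift_inj m k); have := eqb (rshift m i); rewrite !block_permEr.
Qed.

Lemma sign_block_perm (R : comNzRingType) (m k : nat) (pq : 'S_m * 'S_k) :
  (-1) ^+ block_perm pq = (-1) ^+ pq.1 * (-1) ^+ pq.2 :> R.
Proof.
rewrite -!det_perm -(det_ublock _ 0); congr (\det _).
apply/matrixP => i j; rewrite [LHS]mxE [in LHS]mxE.
case: (split_ordP i) => i' ->; case: (split_ordP j) => j' ->;
  rewrite ?block_permEl ?block_permEr.
- by rewrite block_mxEul eq_lshift !mxE.
- by rewrite block_mxEur eq_lrshift !mxE.
- by rewrite block_mxEdl eq_rlshift !mxE.
- by rewrite block_mxEdr eq_rshift !mxE.
Qed.

Lemma block_permP (m k : nat) (s : 'S_(m + k)) :
  (forall (j : 'I_k) (i : 'I_m), s (rshift m j) != lshift k i) ->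
  exists pq, s = block_perm pq.
Proof.
move=> sr.
have /choice[q qE] : forall j, exists j', s (rshift m j) = rshift m j'.
  move=> j; case: (split_ordP (s (rshift m j))) => j' sj; last by exists j'.
  by have := sr j j'; rewrite sj eqxx.
have q_inj : injective q.
  move=> i j eqij; apply/(@rshift_inj m k)/(@perm_inj _ s).
  by rewrite !qE eqij.
have /choice[p pE] : forall i, exists i', s (lshift k i) = lshift k i'.
  move=> i; case: (split_ordP (s (lshift k i))) => j sj; first by exists j.
  have /perm_inj/eqP : s (lshift k i) = s (rshift m ((perm q_inj)^-1 j)%g).
    by rewrite qE sj -[in LHS](permKV (perm q_inj) j) permE.
  by rewrite eq_lrshift.
have p_inj : injective p.
  move=> i j eqij; apply/(@lshift_inj m k)/(@perm_inj _ s).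
  by rewrite !pE eqij.
exists (perm p_inj, perm q_inj); apply/permP => i.
case: (split_ordP i) => j ->.
- by rewrite block_permEl pE permE.
- by rewrite block_permEr qE permE.
Qed.

(* Only the permutations preserving the two blocks contribute, and each of the
   m! k! of them contributes a(E) b(F). *)
Lemma wedge_col_mx (R : realType) (m k n : nat) (a : 'M[R]_(m, n) -> R)
    (b : 'M[R]_(k, n) -> R) (E : 'M[R]_(m, n)) (F : 'M[R]_(k, n)) :
  multilinear a -> Defs.alternating a -> multilinear b -> Defs.alternating b ->
  (forall X i j, row i X = row j E -> b X = 0) ->
  wedge a b (col_mx E F) = a E * b F.
Proof.
move=> mla alta mlb altb bE; rewrite /wedge.
rewrite (bigID (mem (@block_perm m k @: predT)%SET)) /=.
rewrite [X in _ + X]big1 ?addr0 => [|s /imsetP sP]; last first.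
  have [/existsP[j /existsP[i /eqP sj]]|] :=
    boolP [exists j : 'I_k, exists i : 'I_m, s (rshift m j) == lshift k i].
    rewrite (bE (dsubmx (row_perm s (col_mx E F))) j i) ?mulr0 //.
    by apply/rowP => l; rewrite !mxE sj (unsplitK (inl i)).
  move=> /existsPn sr; case: sP.
  have sr' (j : 'I_k) (i : 'I_m) : s (rshift m j) != lshift k i.
    by have /existsPn/(_ i) := sr j.
  by have [pq ->] := block_permP sr'; exists pq.
rewrite big_imset /=; last by move=> p q _ _ /block_perm_inj.
rewrite (eq_bigr (fun=> a E * b F)) => [|pq _].
  rewrite sumr_const card_prod !card_Sn -(mulr_natl (a E * b F)).
  by rewrite mulKf // pnatr_eq0 -lt0n muln_gt0 !fact_gt0.
have -> : usubmx (row_perm (block_perm pq) (col_mx E F)) = perm_mx pq.1 *m E.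
  apply/matrixP => i l; rewrite -row_permE !mxE block_permEl.
  by rewrite (unsplitK (inl _)).
have -> : dsubmx (row_perm (block_perm pq) (col_mx E F)) = perm_mx pq.2 *m F.
  apply/matrixP => i l; rewrite -row_permE !mxE block_permEr.
  by rewrite (unsplitK (inr _)).
rewrite !alternating_mulmx // !det_perm sign_block_perm mulrACA.
by rewrite !signrMK.
Qed.

(** * Positive definite matrices *)

Definition posdef (R : numDomainType) (n : nat) (S : 'M[R]_n) : Prop :=
  S^T = S /\ forall v : 'rV[R]_n, v != 0 -> 0 < (v *m S *m v^T) 0 0.

Lemma posdef_unit (R : numFieldType) (n : nat) (S : 'M[R]_n) :
  posdef S -> S \in unitmx.
Proof.
move=> [_ pS]; rewrite -row_free_unit -kermx_eq0; apply/rowV0P => v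
  /sub_kermxP vS.
by apply: contraTeq isT => /pS; rewrite vS mul0mx mxE ltxx.
Qed.

Lemma posdef_congr (R : numFieldType) (m n : nat) (H : 'M[R]_n)
    (B : 'M[R]_(m, n)) :
  posdef H -> row_free B -> posdef (B *m H *m B^T).
Proof.
move=> [Hsym pH] fB; split; first by rewrite !trmx_mul trmxK Hsym mulmxA.
move=> v v0; have := pH (v *m B); rewrite mulmx_free_eq0 // => /(_ v0).
by rewrite trmx_mul !mulmxA.
Qed.

Lemma cholesky (R : rcfType) (n : nat) (S : 'M[R]_n) :
  posdef S -> exists2 T : 'M[R]_n, is_trig_mx T & T *m T^T = S.
Proof.
elim: n S => [S _|n IHn S [Ssym pS]].
  by exists 0; [apply/is_trig_mxP => - [] | apply/matrixP => - []].
pose A : 'M[R]_(1 + n) := S; pose s := A 0 0.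
pose v := ursubmx A; pose S' := drsubmx A.
have AE : A = block_mx s%:M v v^T S'.
  rewrite -[LHS]submxK; congr block_mx.
    by apply/matrixP => i j; rewrite !ord1 !mxE eqxx mulr1n; congr (A _ _);
      apply/val_inj.
  by rewrite /v trmx_ursub; congr dlsubmx; rewrite -{1}[A]Ssym.
have S'sym : S'^T = S' by rewrite /S' trmx_drsub; congr drsubmx.
have quad (x : R) (w : 'rV[R]_n) :
    (row_mx x%:M w *m A *m (row_mx x%:M w)^T) 0 0 =
    s * x ^+ 2 + 2 * x * (w *m v^T) 0 0 + (w *m S' *m w^T) 0 0.
  have vw : (v *m w^T) 0 0 = (w *m v^T) 0 0.
    by rewrite -[w in RHS]trmxK -trmx_mul [RHS]mxE.
  rewrite AE mul_row_block tr_row_mx mul_row_col tr_scalar_mx mul_mx_scalar.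
  rewrite -scalar_mxM mul_scalar_mx mulmxDl -scalemxAl.
  move: vw; rewrite !mxE eqxx mulr1n => ->.
  ring.
have pos (x : R) (w : 'rV[R]_n) : (x != 0) || (w != 0) ->
    0 < s * x ^+ 2 + 2 * x * (w *m v^T) 0 0 + (w *m S' *m w^T) 0 0.
  rewrite -negb_and -quad => xw; apply: pS.
  rewrite -[_ == _]/(row_mx x%:M w == 0 :> 'rV_(1 + n)) row_mx_eq0.
  apply: contra xw => /andP[/eqP/matrixP/(_ 0 0) x0 ->].
  by move: x0; rewrite !mxE eqxx mulr1n => ->; rewrite eqxx.
have s_gt0 : 0 < s.
  have := pos 1 0; rewrite oner_eq0 => /(_ isT).
  by rewrite !mul0mx !mxE expr1n !mulr1 mulr0 !addr0.
pose S'' := S' - s^-1 *: (v^T *m v).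
have [T' trigT' TS''] : exists2 T : 'M[R]_n, is_trig_mx T & T *m T^T = S''.
  apply: IHn; split.
    by rewrite linearB linearZ /= trmx_mul trmxK S'sym.
  move=> w w0; pose x := - (w *m v^T) 0 0 / s.
  have := pos x w; rewrite w0 orbT.
  move=> /(_ isT); congr (_ < _).
  rewrite mulmxBr mulmxBl -scalemxAr -scalemxAl !mulmxA -(mulmxA (w *m v^T) v).
  rewrite (mx11_scalar (w *m v^T)) mul_scalar_mx.
  have -> : v *m w^T = (w *m v^T)^T by rewrite trmx_mul trmxK.
  rewrite /x !mxE eqxx mulr1n; field; exact: lt0r_neq0.
have sq : Num.sqrt s * Num.sqrt s = s by rewrite -expr2 sqr_sqrtr // ltW.
have sq0 : Num.sqrt s != 0 by rewrite sqrtr_eq0 -ltNge.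
exists (block_mx (Num.sqrt s)%:M 0 ((Num.sqrt s)^-1 *: v^T) T').
  rewrite (@is_trig_block_mx _ 1 n 1 n) // eqxx trigT' andbT /=.
  by apply/is_trig_mxP => i j; rewrite !ord1.
change (block_mx (Num.sqrt s)%:M 0 ((Num.sqrt s)^-1 *: v^T) T' *m
  (block_mx (Num.sqrt s)%:M 0 ((Num.sqrt s)^-1 *: v^T) T')^T = A).
rewrite AE tr_block_mx mulmx_block !trmx0 !mulmx0 !mul0mx !addr0.
rewrite tr_scalar_mx -scalar_mxM sq linearZ /= trmxK mul_scalar_mx
  mul_mx_scalar.
rewrite !scalerA mulfV // !scale1r TS'' -scalemxAl -scalemxAr scalerA -invfM sq.
by rewrite /S'' addrC subrK.
Qed.

Lemma posdef_det_gt0 (R : rcfType) (n : nat) (S : 'M[R]_n) :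
  posdef S -> 0 < \det S.
Proof.
move=> pS; have := posdef_unit pS; have [T _ <-] := cholesky pS.
rewrite unitmxE unitfE det_mulmx det_tr -expr2 => d0.
by rewrite lt0r d0 sqr_ge0.
Qed.

Lemma mxtrace_mul_tr (R : comNzRingType) (m n : nat) (X : 'M[R]_(m, n)) :
  \tr (X *m X^T) = \sum_i \sum_j X i j ^+ 2.
Proof.
apply: eq_bigr => i _; rewrite mxE; apply: eq_bigr => j _.
by rewrite mxE expr2.
Qed.

(* With S = T T^T for T lower triangular, det S is the product of the T_ii^2,
   while tr S is the sum of all the T_ij^2. *)
Lemma det_le_trace (R : rcfType) (k : nat) (S : 'M[R]_k) :
  (0 < k)%N -> posdef S ->
  \det S <= (\tr S / k%:R) ^+ k ?= iff (S == (\tr S / k%:R)%:M).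
Proof.
move=> k0 pS; have [T trT TS] := cholesky pS.
have kR : 0 < k%:R :> R by rewrite ltr0n.
have trE : \tr S = \sum_i \sum_j T i j ^+ 2.
  by rewrite -TS mxtrace_mul_tr.
have detE : \det S = \prod_i T i i ^+ 2.
  by rewrite -TS det_mulmx det_tr -expr2 det_trig // prodrXl.
pose mu := (\sum_i T i i ^+ 2) / k%:R.
have le_row i : T i i ^+ 2 <= \sum_j T i j ^+ 2.
  by rewrite (bigD1 i) //= lerDl sumr_ge0 // => j _; rewrite sqr_ge0.
have mu0 : 0 <= mu by rewrite divr_ge0 ?sumr_ge0 // ?ltW// => i _; rewrite
  sqr_ge0.
have mu_le : mu <= \tr S / k%:R.
  by rewrite ler_pM2r ?invr_gt0 // trE ler_sum.
have le2 : mu ^+ k <= (\tr S / k%:R) ^+ k.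
  by rewrite lerXn2r // nnegrE ?(le_trans mu0).
have agm : \det S <= mu ^+ k
    ?= iff [forall i in 'I_k, forall j in 'I_k, T i i ^+ 2 == T j j ^+ 2].
  rewrite detE; have := @leif_AGM _ 'I_k 'I_k (fun i => T i i ^+ 2).
  rewrite card_ord /= => H; apply: H => i _; exact: sqr_ge0.
apply/leifP; case: ifPn => [/eqP SE|SN].
  by apply/eqP; rewrite [in LHS]SE det_scalar.
rewrite lt_neqAle (le_trans agm.1 le2) andbT.
apply: contra SN => /eqP detS.
have eq2 : mu ^+ k = (\tr S / k%:R) ^+ k.
  by apply/eqP; rewrite eq_le le2 -detS agm.1.
have eqmu : mu = \tr S / k%:R.
  by apply/eqP; rewrite -(eqrXn2 k0) ?eq2// (le_trans mu0).
have /forall_inP eqd : [forall i in 'I_k, forall j in 'I_k, T i i ^+ 2 == T j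
  j ^+ 2].
  by rewrite -agm.2 detS eq2.
have sumT : \sum_i (\sum_j T i j ^+ 2 - T i i ^+ 2) = 0.
  rewrite sumrB -trE; apply/eqP; rewrite subr_eq0; apply/eqP.
  by apply: (mulIf (x := k%:R^-1)); rewrite ?invr_eq0 ?gt_eqF// -eqmu.
have offd i j : i != j -> T i j = 0.
  move=> ij; have /eqP := sumT.
  rewrite psumr_eq0 => [/allP/(_ i)|p _]; last by rewrite subr_ge0.
  rewrite mem_index_enum => /(_ isT) /=.
  rewrite (bigD1 i) //= [X in X - _]addrC addrK psumr_eq0 => [/allP/(_ j)|p
    _]; last exact: sqr_ge0.
  by rewrite mem_index_enum eq_sym ij => /(_ isT) /=; rewrite sqrf_eq0 => /eqP.
have mudiag i : T i i ^+ 2 = mu.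
  rewrite /mu (eq_bigr (fun=> T i i ^+ 2)) => [|j _].
    by rewrite sumr_const card_ord -[X in X / _]mulr_natr mulfK // gt_eqF.
  by have /forall_inP/(_ i isT)/eqP := eqd j isT.
apply/eqP/matrixP => i j; rewrite -eqmu -{1}TS !mxE (bigD1 i) //= big1 ?addr0.
  rewrite mxE; have [<-|ij] := eqVneq i j; first by rewrite -expr2 mudiag.
  by rewrite (offd j i) ?mulr0 // eq_sym.
by move=> l il; rewrite offd ?mul0r // eq_sym.
Qed.

Lemma exists_orthonormal_basis (R : realType) (m n : nat) (H V : 'M[R]_n) :
  posdef H -> \rank V = m -> exists E : 'M[R]_(m, n), orthonormal_basis H V E.
Proof.
move=> pH; case: m / => //.
have [B fB BV] : exists2 B : 'M[R]_(\rank V, n), row_free B & (B :=: V)%MS.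
  by exists (row_base V); [exact: row_base_free | exact: eq_row_base].
have pB := posdef_congr pH fB; have [T _ TE] := cholesky pB.
have Tu : T \in unitmx.
  by have := posdef_unit pB; rewrite -TE unitmx_mul => /andP[].
exists (invmx T *m B); split.
  rewrite /orthonormal_frame trmx_mul !mulmxA -!(mulmxA (invmx T)) -TE.
  by rewrite -mulmxA mulKmx // -trmx_mul mulVmx // trmx1.
apply/eqmxP; apply: eqmx_trans (eqmxMfull _ _) BV.
by rewrite row_full_unit unitmx_inv.
Qed.

Lemma exists_reflection (R : realType) (m : nat) :
  (0 < m)%N -> exists2 Q : 'M[R]_m, Q *m Q^T = 1%:M & \det Q = -1.
Proof.
case: m => // m _; pose d : 'rV[R]_m.+1 := \row_i (-1) ^+ (i == ord0).
exists (diag_mx d).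
  rewrite tr_diag_mx mulmx_diag -diag_const_mx; congr diag_mx.
  by apply/rowP => i; rewrite !mxE -expr2 sqrr_sign.
rewrite det_diag big_ord_recl big1 => [|i _]; first by rewrite mxE expr1 mulr1.
by rewrite mxE.
Qed.

Lemma orthonormal_basis_mul (R : realType) (m n : nat) (H V : 'M[R]_n)
    (E : 'M[R]_(m, n)) (Q : 'M[R]_m) :
  Q *m Q^T = 1%:M -> orthonormal_basis H V E -> orthonormal_basis H V (Q *m E).
Proof.
move=> QQ [onE /eqmxP EV]; split.
  rewrite /orthonormal_frame trmx_mul.
  have -> : Q *m E *m H *m (E^T *m Q^T) = Q *m (E *m H *m E^T) *m Q^T.
    by rewrite !mulmxA.
  by rewrite onE mulmx1.
apply/eqmxP; apply: eqmx_trans (eqmxMfull _ _) EV.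
by rewrite row_full_unit; case/mulmx1_unit: QQ.
Qed.

Lemma orthonormal_col_mx (R : realType) (m k n : nat) (H V : 'M[R]_n)
    (E : 'M[R]_(m, n)) (F : 'M[R]_(k, n)) :
  H^T = H -> orthonormal_basis H V E ->
  orthonormal_basis H (orthocomplement H V) F ->
  orthonormal_frame H (col_mx E F).
Proof.
move=> Hsym [onE /andP[/submxP[X EV] _]] [onF /andP[/sub_kermxP FV _]].
have FE : F *m H *m E^T = 0.
  have -> : F *m H *m E^T = F *m (H *m V^T) *m X^T.
    by rewrite EV trmx_mul !mulmxA.
  by rewrite FV mul0mx.
have EF : E *m H *m F^T = 0.
  by apply: trmx_inj; rewrite !trmx_mul trmxK Hsym mulmxA FE trmx0.
by rewrite /orthonormal_frame mul_col_mx tr_col_mx mul_col_row onE onF EF FE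
  scalar_mx_block.
Qed.

(** * Frames adapted to the kernel of the differential *)

Section AdaptedFrames.

Variables (R : realType) (m k : nat) (H : 'M[R]_(m + k)) (G : 'M[R]_k).
Variables (D : 'M[R]_(m + k, k)) (a : 'M[R]_(m, m + k) -> R) (eM eL : bool).

Implicit Types (E : 'M[R]_(m, m + k)) (F : 'M[R]_(k, m + k)) (A C : 'M[R]_(m +
  k)).

Hypotheses (k_gt0 : (0 < k)%N) (pH : posdef H) (pG : posdef G).
Hypotheses (a_mlin : multilinear a) (a_alt : Defs.alternating a).
Hypothesis a_calib : forall E, orthonormal_frame H E -> `|a E| <= 1.

Let K := kermx D.
Let P := orthocomplement H K.
Let volM (A : 'M[R]_(m + k)) := (-1) ^+ eM * Num.sqrt (\det H) * \det A.
Let b := pullback_form (m := k) D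
  (fun X : 'M[R]_k => (-1) ^+ eL * Num.sqrt (\det G) * \det X).
Let W := wedge a b.
Let lam := Num.sqrt (trace_wrt H (pullback_bilin D G)) / Num.sqrt k%:R.
Let S (F : 'M[R]_(k, m + k)) := F *m D *m G *m (F *m D)^T.

Lemma pullback_vol_multilinear : multilinear b.
Proof.
apply: multilinear_mulmxr => i r A B C eA eB eC.
by rewrite (multilinear_det eA eB eC) mulrDr mulrCA.
Qed.

Lemma pullback_vol_alternating : Defs.alternating b.
Proof.
apply: alternating_mulmxr => A i j ij eqA.
by rewrite (alternating_det ij eqA) mulr0.
Qed.

Lemma wedge_pullbackE A : W A = W 1%:M * \det A.
Proof.
apply: top_formE; last exact: alternating_wedge.
exact: multilinear_wedge pullback_vol_multilinear.
Qed.

Lemma wedge_pullback_proportional C A :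
  volM C ^+ 2 = 1 -> W A = W C * volM C * volM A.
Proof.
move=> vC; rewrite wedge_pullbackE (wedge_pullbackE C) -[LHS]mulr1 -vC /volM;
  ring.
Qed.

Lemma wedge_pullback_rank_lt A : (\rank D < k)%N -> W A = 0.
Proof.
move=> rD; rewrite /W /wedge big1 ?mulr0 // => s _.
suff /eqP d0 : \det (dsubmx (row_perm s A) *m D) == 0.
  by rewrite /b /pullback_form d0 !mulr0.
rewrite -[_ == 0]negbK -unitfE -unitmxE -row_full_unit /row_full.
by rewrite neq_ltn (leq_ltn_trans (mxrankM_maxr _ _) rD).
Qed.

Lemma dilation_ge0 : 0 <= lam.
Proof. by rewrite divr_ge0 ?sqrtr_ge0. Qed.

Lemma orthonormal_vol C : orthonormal_frame H C -> volM C ^+ 2 = 1.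
Proof.
move=> /(congr1 determinant); rewrite !det_mulmx det_tr det1 => <-.
rewrite /volM !exprMn sqrr_sign sqr_sqrtr ?ltW ?posdef_det_gt0 //; ring.
Qed.

Lemma orthonormal_trace C (B : 'M[R]_(m + k)) :
  orthonormal_frame H C -> trace_wrt H B = \tr (C *m B *m C^T).
Proof.
move=> onC; rewrite /trace_wrt; have -> : invmx H = C^T *m C.
  have Hu := posdef_unit pH; apply: (can_inj (mulmxK Hu)).
  rewrite mulVmx // -mulmxA; apply/esym/mulmx1C.
  exact: onC.
by rewrite -[in LHS]mulmxA [LHS]mxtrace_mulC.
Qed.

Lemma orthonormal_unit C :
  orthonormal_frame H C -> C \in unitmx.
Proof. by rewrite /orthonormal_frame -mulmxA => /mulmx1_unit[]. Qed.

Lemma trace_pullbackE : exists2 X : 'M[R]_(m + k, k),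
  trace_wrt H (pullback_bilin D G) = \sum_i \sum_j X i j ^+ 2 & X = 0 -> D = 0.
Proof.
have [C [onC _]] := exists_orthonormal_basis pH (mxrank1 R (m + k)).
have [T _ TG] := cholesky pG.
have Tu : T \in unitmx.
  by have := posdef_unit pG; rewrite -TG unitmx_mul => /andP[].
exists (C *m D *m T) => [|X0].
  rewrite (orthonormal_trace _ onC) -mxtrace_mul_tr !trmx_mul /pullback_bilin.
  by rewrite -TG !mulmxA.
by rewrite -(mulKmx (orthonormal_unit onC) D) -(mulmxK Tu (C *m D)) X0 mul0mx
  mulmx0.
Qed.

Lemma trace_pullback_ge0 : 0 <= trace_wrt H (pullback_bilin D G).
Proof.
have [X -> _] := trace_pullbackE; apply: sumr_ge0 => i _.
by apply: sumr_ge0 => j _; apply: sqr_ge0.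
Qed.

Lemma dilation_sqr : lam ^+ 2 = trace_wrt H (pullback_bilin D G) / k%:R.
Proof. by rewrite expr_div_n !sqr_sqrtr ?ler0n ?trace_pullback_ge0. Qed.

Lemma dilation_eq0 : lam = 0 <-> D = 0.
Proof.
split=> [lam0|D0]; last first.
  by apply/eqP; rewrite -sqrf_eq0 dilation_sqr /pullback_bilin /trace_wrt D0
    !mul0mx
    mulmx0 mxtrace0 mul0r.
have := dilation_sqr; rewrite lam0 expr0n /= => /esym/eqP.
rewrite mulf_eq0 invr_eq0 pnatr_eq0 gtn_eqF // orbF.
have [X -> X0] := trace_pullbackE; rewrite psumr_eq0 => [/allP sX|i _]; last
  first.
  by apply: sumr_ge0 => j _; apply: sqr_ge0.
apply: X0; apply/matrixP => i j; rewrite mxE; apply/eqP; rewrite -sqrf_eq0.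
have := sX i (mem_index_enum i); rewrite psumr_eq0 => [/allP/(_ j)|l _].
  by rewrite mem_index_enum; apply.
exact: sqr_ge0.
Qed.

Lemma rank_ker : \rank D = k -> \rank K = m.
Proof. by move=> rD; rewrite mxrank_ker rD addnK. Qed.

Lemma rank_orthocomplement_ker : \rank D = k -> \rank P = k.
Proof.
move=> rD; rewrite mxrank_ker eqmxMfull ?mxrank_tr ?rank_ker ?addKn //.
by rewrite row_full_unit posdef_unit.
Qed.

Lemma adapted_orthonormal E F :
  orthonormal_basis H K E -> orthonormal_basis H P F ->
  orthonormal_frame H (col_mx E F).
Proof. exact: orthonormal_col_mx pH.1. Qed.

Lemma ker_basis_mul E :
  orthonormal_basis H K E -> E *m D = 0.
Proof. by move=> [_ /andP[/sub_kermxP]]. Qed.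

Lemma adapted_wedge E F :
  orthonormal_basis H K E -> W (col_mx E F) = a E * b F.
Proof.
move=> bE; apply: wedge_col_mx => //.
- exact: pullback_vol_multilinear.
- exact: pullback_vol_alternating.
move=> X i j eqX; apply: (multilinear_row0 (f := fun Y => _ * \det Y) (i := i)).
  move=> p r A B C eA eB eC.
  by rewrite (multilinear_det eA eB eC) mulrDr mulrCA.
by rewrite row_mul eqX -row_mul ker_basis_mul // row0.
Qed.

Lemma adapted_unit E F :
  orthonormal_basis H K E -> orthonormal_basis H P F ->
  \rank D = k -> F *m D \in unitmx.
Proof.
move=> bE bF rD; have onC := adapted_orthonormal bE bF.
have : \rank (col_mx E F *m D) = k.
  by rewrite eqmxMfull // row_full_unit orthonormal_unit.
rewrite mul_col_mx ker_basis_mul // -addsmxE adds0mx => rFD.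
by rewrite -row_full_unit /row_full rFD.
Qed.

Lemma adapted_trace E F :
  orthonormal_basis H K E -> orthonormal_basis H P F ->
  trace_wrt H (pullback_bilin D G) = \tr (S F).
Proof.
move=> bE bF; rewrite (orthonormal_trace _ (adapted_orthonormal bE bF)).
rewrite /pullback_bilin !mulmxA -mulmxA -trmx_mul mul_col_mx ker_basis_mul //.
rewrite tr_col_mx trmx0 mul_col_mx mul0mx mul_col_row !mulmx0 !mul0mx.
by rewrite mxtrace_block mxtrace0 add0r.
Qed.

Lemma pullback_vol_sqr F : b F ^+ 2 = \det (S F).
Proof.
rewrite /b /pullback_form /S 2!det_mulmx det_tr !exprMn sqrr_sign.
by rewrite sqr_sqrtr ?ltW ?posdef_det_gt0 //; ring.
Qed.

Lemma adapted_pullback_vol_le E F :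
  orthonormal_basis H K E -> orthonormal_basis H P F -> \rank D = k ->
  `|b F| <= lam ^+ k ?= iff (S F == (lam ^+ 2)%:M).
Proof.
move=> bE bF rD; have FDu := adapted_unit bE bF rD.
have pS : posdef (S F) by apply: posdef_congr; rewrite // row_free_unit.
have := det_le_trace k_gt0 pS; rewrite -(adapted_trace bE bF) -dilation_sqr
  -pullback_vol_sqr.
rewrite -exprM mulnC exprM => -[le eqS].
have lk : 0 <= lam ^+ k by rewrite exprn_ge0 // dilation_ge0.
split.
  by rewrite -(@ler_pXn2r _ 2) ?nnegrE // real_normK ?num_real.
by rewrite -eqS -(@eqrXn2 _ 2 `|b F|) // real_normK ?num_real.
Qed.

Lemma adapted_pullback_vol_neq0 E F :
  orthonormal_basis H K E -> orthonormal_basis H P F -> \rank D = k ->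
  b F != 0.
Proof.
move=> bE bF rD; have FDu := adapted_unit bE bF rD.
rewrite -sqrf_eq0 pullback_vol_sqr gt_eqF // posdef_det_gt0 //.
by apply: posdef_congr; rewrite // row_free_unit.
Qed.

Definition adapted_coef E F := a E * b F * volM (col_mx E F).

Lemma adapted_wedgeE E F A :
  orthonormal_basis H K E -> orthonormal_basis H P F ->
  W A = adapted_coef E F * volM A.
Proof.
move=> bE bF; have vC := orthonormal_vol (adapted_orthonormal bE bF).
by rewrite (wedge_pullback_proportional _ vC) adapted_wedge.
Qed.

Lemma adapted_coef_le E F :
  orthonormal_basis H K E -> orthonormal_basis H P F ->
  adapted_coef E F <= `|b F|.
Proof.
move=> bE bF; have vC := orthonormal_vol (adapted_orthonormal bE bF).
apply: le_trans (ler_norm _) _; rewrite /adapted_coef (normrM (a E * b F))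
  (normrM (a E)).
have -> : `|volM (col_mx E F)| = 1.
  by apply/eqP; rewrite -(@eqrXn2 _ 2) // real_normK ?num_real // vC expr1n.
by rewrite mulr1 ler_piMl // a_calib //; case: bE.
Qed.

Lemma adapted_coef_eq E F :
  orthonormal_basis H K E -> orthonormal_basis H P F -> \rank D = k ->
  adapted_coef E F = lam ^+ k <->
  S F = (lam ^+ 2)%:M /\ adapted_coef E F = `|b F|.
Proof.
move=> bE bF rD; have le1 := adapted_coef_le bE bF.
have [le2 eq2] := adapted_pullback_vol_le bE bF rD; split=> [eqc|[/eqP eqS
  ->]]; last first.
  by apply/eqP; rewrite eq2.
have eqb : `|b F| = lam ^+ k by apply/eqP; rewrite eq_le le2 -eqc.
by split; [apply/eqP; rewrite -eq2 eqb | rewrite eqb].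
Qed.

Lemma equality_adapted_coef E F :
  orthonormal_basis H K E -> orthonormal_basis H P F ->
  (forall A, W A = lam ^+ k * volM A) <-> adapted_coef E F = lam ^+ k.
Proof.
move=> bE bF; split=> [eqW|eqc A]; last by rewrite (adapted_wedgeE _ bE bF) eqc.
have := eqW (col_mx E F); rewrite (adapted_wedgeE _ bE bF).
have vC := orthonormal_vol (adapted_orthonormal bE bF).
by apply: mulIf; rewrite -sqrf_eq0 vC oner_eq0.
Qed.

Lemma conformal_adapted E F :
  orthonormal_basis H K E -> orthonormal_basis H P F -> \rank D = k ->
  (exists2 B, horizontal_part D H B & pullback_bilin D G = lam ^+ 2 *: B) <->
  S F = (lam ^+ 2)%:M.
Proof.
move=> bE bF rD; have [onF /andP[FP PF]] := bF.
have SE : S F = F *m pullback_bilin D G *m F^T.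
  by rewrite /S /pullback_bilin trmx_mul !mulmxA.
have lam0 : lam ^+ 2 != 0.
  rewrite sqrf_eq0; apply/eqP => /dilation_eq0 D0; move: rD k_gt0.
  by rewrite D0 mxrank0 => <-.
split=> [[B [hB _] DB]|SF].
  rewrite SE DB -scalemxAr -scalemxAl -scalemx1; congr (_ *: _); rewrite -onF.
  apply/matrixP => i j.
  have rowP l : (row l F <= P)%MS := submx_trans (row_sub l F) FP.
  have entry X : (F *m X *m F^T) i j = (row i F *m X *m (row j F)^T) 0 0.
    by rewrite -row_mul tr_row !mxE; apply: eq_bigr => l _; rewrite !mxE.
  by rewrite !entry hB.
exists ((lam ^+ 2)^-1 *: pullback_bilin D G); last first.
  by rewrite scalerA mulfV // scale1r.
split=> [v w vP wP|v w /orP[/sub_kermxP vD|/sub_kermxP wD]].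
- have /submxP[x ->] := submx_trans vP PF.
  have /submxP[y ->] := submx_trans wP PF.
  rewrite -scalemxAr -scalemxAl trmx_mul.
  have -> X : x *m F *m X *m (F^T *m y^T) = x *m (F *m X *m F^T) *m y^T.
    by rewrite !mulmxA.
  have -> X : x *m F *m X *m (F^T *m y^T) = x *m (F *m X *m F^T) *m y^T.
    by rewrite !mulmxA.
  rewrite onF -SE SF mulmx1 mul_mx_scalar -scalemxAl scalerA mulVf //.
  by rewrite scale1r.
- by rewrite /pullback_bilin -scalemxAr -scalemxAl !mulmxA vD !mul0mx scaler0.
- by rewrite /pullback_bilin -scalemxAr -scalemxAl -!mulmxA -trmx_mul wD trmx0
    !mulmx0 scaler0.
Qed.

Lemma exists_positive_basis E :
  orthonormal_basis H K E -> \rank D = k ->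
  exists2 F, orthonormal_basis H P F & 0 < b F.
Proof.
move=> bE rD.
have [F bF] := exists_orthonormal_basis pH (rank_orthocomplement_ker rD).
have [|bF0|bF0] := ltgtP 0 (b F); first by exists F.
  have [Q QQ dQ] := @exists_reflection R k k_gt0.
  exists (Q *m F); first exact: orthonormal_basis_mul.
  rewrite (alternating_mulmx _ _ pullback_vol_multilinear
    pullback_vol_alternating) dQ mulN1r.
  by rewrite oppr_gt0.
by have := adapted_pullback_vol_neq0 bE bF rD; rewrite -bF0 eqxx.
Qed.

Definition positive_frame E := exists F,
  [/\ orthonormal_basis H P F, 0 < b F & 0 < volM (col_mx E F)].

Lemma orthonormal_vol_cases C : orthonormal_frame H C -> volM C = 1 \/ volM C
  = -1.
Proof.
move=> /orthonormal_vol/eqP; rewrite sqrf_eq1 => /orP[]/eqP; by [left|right].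
Qed.

Lemma wedge_pullback_eq_full_rank : \rank D = k ->
  (forall A, W A = lam ^+ k * volM A) <->
  (exists2 B, horizontal_part D H B & pullback_bilin D G = lam ^+ 2 *: B) /\
  calibrated_subspace H a K positive_frame.
Proof.
move=> rD; split=> [eqW|[conf [E bE calE]]]; last first.
  have [F [bF bF0 cF]] : exists F, [/\ orthonormal_basis H P F,
      0 < b F & a E * volM (col_mx E F) = 1].
    case: calE => [[[F [bF bF0 vF]] ->]|[_ nE ->]].
      exists F; split; rewrite // mul1r.
      have [//|vN] := orthonormal_vol_cases (adapted_orthonormal bE bF).
      by rewrite vN oppr_gt0 ltr10 in vF.
    have [F bF bF0] := exists_positive_basis bE rD; exists F; split=> //.
    have [v1|->] := orthonormal_vol_cases (adapted_orthonormal bE bF); last by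
      rewrite mulrNN mulr1.
    by case: nE; exists F; rewrite v1 ltr01.
  apply/(equality_adapted_coef bE bF)/(adapted_coef_eq bE bF rD).
  split; first by apply/(conformal_adapted bE bF rD).
  by rewrite /adapted_coef mulrAC cF mul1r gtr0_norm.
have coef E F : orthonormal_basis H K E -> orthonormal_basis H P F -> 0 < b F ->
    a E * volM (col_mx E F) = 1.
  move=> bE bF bF0; have /(adapted_coef_eq bE bF rD)[_] :=
    (equality_adapted_coef bE bF).1 eqW.
  rewrite /adapted_coef mulrAC gtr0_norm // -[RHS]mul1r; apply: mulIf.
  by rewrite gt_eqF.
have [E bE] := exists_orthonormal_basis pH (rank_ker rD).
have [F bF bF0] := exists_positive_basis bE rD.
split.
  apply/(conformal_adapted bE bF rD).
  by have /(adapted_coef_eq bE bF rD)[] := (equality_adapted_coef bE bF).1 eqW.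
have calib E' : orthonormal_basis H K E' -> a E' = 1 ->
    calibrated_subspace H a K positive_frame.
  move=> bE' aE'; exists E' => //; left; split=> //; exists F; split=> //.
  by have := coef E' F bE' bF bF0; rewrite aE' mul1r => ->.
have := coef E F bE bF bF0.
have [->|->] := orthonormal_vol_cases (adapted_orthonormal bE bF).
  by rewrite mulr1; apply: calib.
rewrite mulrN1 => aE; have {}aE : a E = -1 by rewrite -aE opprK.
have [m0|m_gt0] := posnP m.
  exists E => //; right; split=> // - [F' [bF' bF'0]].
  have := coef E F' bE bF' bF'0; rewrite aE mulN1r => vF.
  by rewrite -[volM _]opprK vF oppr_gt0 ltr10.
have [Q QQ dQ] := @exists_reflection R m m_gt0.
apply: (calib (Q *m E)); first exact: orthonormal_basis_mul.
by rewrite alternating_mulmx // dQ aE mulrNN mulr1.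
Qed.

Lemma wedge_pullback_le :
  exists p q : R, [/\ forall A, W A = p * volM A,
    forall A, lam ^+ k * volM A = q * volM A & p <= q].
Proof.
have := rank_leq_col D; rewrite leq_eqVlt => /orP[/eqP rD|rD]; last first.
  exists 0, (lam ^+ k); split=> // [A|]; first by rewrite
    wedge_pullback_rank_lt // mul0r.
  by rewrite exprn_ge0 // dilation_ge0.
have [E bE] := exists_orthonormal_basis pH (rank_ker rD).
have [F bF] := exists_orthonormal_basis pH (rank_orthocomplement_ker rD).
exists (adapted_coef E F), (lam ^+ k); split=> // [A|].
  exact: adapted_wedgeE.
exact: le_trans (adapted_coef_le bE bF) (adapted_pullback_vol_le bE bF rD).1.
Qed.

Lemma wedge_pullback_eq :
  (forall A, W A = lam ^+ k * volM A) <->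
  (D = 0 \/ \rank D = k /\
    exists2 B, horizontal_part D H B & pullback_bilin D G = lam ^+ 2 *: B) /\
  (D <> 0 -> calibrated_subspace H a K positive_frame).
Proof.
have := rank_leq_col D; rewrite leq_eqVlt => /orP[/eqP rD|rD].
  have D0 : D <> 0 by move=> D0; move: rD k_gt0; rewrite D0 mxrank0 => <-.
  rewrite wedge_pullback_eq_full_rank //; split=> [[cB cE]|[[//|[_ cB]] cE]].
    by split=> //; right.
  by split=> //; apply: cE.
split=> [eqW|[[D0|[rDk]] _] A]; last 1 first.
- by rewrite rDk ltnn in rD.
- suff D0 : D = 0 by split=> [|/(_ D0)//]; left.
  have [C [onC _]] := exists_orthonormal_basis pH (mxrank1 R (m + k)).
  have := eqW C; rewrite wedge_pullback_rank_lt // => /esym/eqP; rewrite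
    mulf_eq0 expf_eq0 k_gt0.
  have vC := orthonormal_vol onC.
  have -> : (volM C == 0) = false by rewrite -sqrf_eq0 vC oner_eq0.
  by rewrite orbF /= => /eqP/dilation_eq0.
- by rewrite wedge_pullback_rank_lt // dilation_eq0.2 // expr0n gtn_eqF //
  mul0r.
Qed.

End AdaptedFrames.

Lemma linear_calibration_theorem (R : realType) (m k n : nat) (e : (m + k)%N =
  n)
    (H : 'M[R]_n) (G : 'M[R]_k) (D : 'M[R]_(n, k)) (a : 'M[R]_(m, n) -> R)
    (eM eL : bool)
    (volM := fun A : 'M[R]_n => (-1) ^+ eM * Num.sqrt (\det H) * \det A)
    (b := pullback_form D
      (fun A : 'M[R]_k => (-1) ^+ eL * Num.sqrt (\det G) * \det A))
    (W := castdeg e (wedge a b))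
    (lam := Num.sqrt (trace_wrt H (pullback_bilin D G)) / Num.sqrt k%:R) :
  (0 < k)%N -> posdef H -> posdef G -> multilinear a -> Defs.alternating a ->
  (forall E, orthonormal_frame H E -> `|a E| <= 1) ->
  top_form_le volM W (fun A => lam ^+ k * volM A) /\
  ((forall A, W A = lam ^+ k * volM A) <->
   (D = 0 \/ \rank D = k /\
     exists2 B, horizontal_part D H B & pullback_bilin D G = lam ^+ 2 *: B) /\
   (D <> 0 -> calibrated_subspace H a (kermx D) (fun E => exists F,
     [/\ orthonormal_basis H (orthocomplement H (kermx D)) F, 0 < b F &
         0 < volM (castmx (e, erefl n) (col_mx E F))]))).
Proof.
case: n / e => /= in H D a volM b W lam *.
move=> k_gt0 pH pG mla alta cala; split.
  exact: wedge_pullback_le.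
exact: wedge_pullback_eq.
Qed.

Lemma metric_posdef (R : realType) (n : nat) (M : manifold R n) (h : metric M)
    (x : M) : posdef (h x).
Proof.
by split; [exact: Defs.metric_sym | exact: Defs.metric_pos].
Qed.

Theorem theorem4p9 (R : realType) (n k : nat) (k_gt0 : (0 < k)%N)
    (le_kn : (k <= n)%N)
    (M : manifold R n) (h : metric M) (oM : orientation M)
    (L : manifold R k) (g : metric L) (oL : orientation L)
    (u : M -> L) (u_smooth : smooth_map u)
    (u_surj : forall p : L, exists x : M, u x = p)
    (alpha : dform M (n - k)) (alpha_calib : calibration h alpha) :
  (forall x : M,
     top_form_le (vol h oM x)
       (wedge_pullback_vol le_kn g oL u alpha x)
       (fun A => dilation h g u x ^+ k * vol h oM x A)) /\
  ((forall (x : M) (A : 'M[R]_n),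
      wedge_pullback_vol le_kn g oL u alpha x A =
      dilation h g u x ^+ k * vol h oM x A) <->
   (weakly_horizontally_conformal h g u /\
    calibrated_fibres le_kn h oM g oL u alpha)).
Proof.
have pt (x : M) := linear_calibration_theorem (subnK le_kn) (tangent_map u x)
  (oM x) (oL (u x))
  k_gt0 (metric_posdef h x) (metric_posdef g (u x)) (@dform_multilinear _ _ _
    _ alpha x)
  (@dform_alternating _ _ _ _ alpha x) (@alpha_calib x).
split=> [x|]; first exact: (pt x).1.
split=> [eqW|[conf cal] x]; last first.
  apply/(pt x).2; split; first exact: conf.
  by move=> Dx; apply: (cal (u x)).
by split=> [x|p x [Dx _]]; have [cx calx] := (pt x).2.1 (eqW x); [exact: cx |
  exact: calx].
Qed.
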